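(* For $n\ge 4$ let $G_n=\overline{C_n}$ be the graph complement of the cycle graph with $n$ vertices, with automorphism group $\mathrm{Aut}(G_n)$ (the dihedral group with $2n$ elements). The set of possible Lefschetz numbers $\{\chi(G_n,T): T\in\mathrm{Aut}(G_n)\}$ is $12$-periodic in $n$, that is, it is the same for $n$ and $n+12$ for all $n\ge 4$. The average Lefschetz number $$\frac{1}{|\mathrm{Aut}(G_n)|}\sum_{T\in \mathrm{Aut}(G_n)}\chi(G_n,T)$$ is equal to $1$, except for the cases $n=12k-1$ and $n=12k+1$ (with $k\ge 1$ an integer), where it is equal to $0$.
   Context: For a finite simple graph $G$ let $H^k(G)$ be the $k$-th simplicial cohomology group with real coefficients of the Whitney complex of $G$, whose simplices are the vertex sets of the nonempty complete subgraphs. An automorphism $T$ of $G$ induces linear maps $T|H^k(G)$, and its Lefschetz number is $\chi(G,T)=\sum_{k}(-1)^k\,\mathrm{tr}(T|H^k(G))$. *)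

(* Defs.v *)
From HB Require Import structures.
From mathcomp Require Import all_boot all_order all_algebra all_fingroup.
From mathcomp Require Import classical_sets reals.

Set Implicit Arguments.
Unset Strict Implicit.
Unset Printing Implicit Defensive.

Import GRing.Theory passmx.
Local Open Scope ring_scope.

Section LinearAlgebra.
Context {F : fieldType} {vT : vectType F}.

Definition lftrace (f : 'End(vT)) : F :=
  \tr (mxof (vbasis {:vT}) (vbasis {:vT}) f).

(* The quotient V / U, for U a subspace of V, is realized on the complement   *)
(* V :\: U of U in V; quot_class is the canonical projection V -> V / U, as   *)
(* established by quot_class_surj and quot_class_eq0.                         *)
Definition quotv (V U : {vspace vT}) := subvs_of (V :\: U).

HB.instance Definition _ (V U : {vspace vT}) := Vector.on (quotv V U).

Definition quot_class (V U : {vspace vT}) : 'Hom(vT, quotv V U) :=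
  linfun (vsproj (V :\: U) \o addv_pi1 V U).

(* This is the map induced by f only if f maps V into V and U into U, see     *)
(* quot_map_class.                                                            *)
Definition quot_map (V U : {vspace vT}) (f : 'End(vT)) : 'End(quotv V U) :=
  linfun (quot_class V U \o f \o vsval).

Lemma quot_class_surj (V U : {vspace vT}) (c : quotv V U) :
  exists2 v, v \in V & quot_class V U v = c.
Proof.
exists (vsval c); first by rewrite (subvP (diffvSl V U)) // subvsP.
by rewrite lfunE /= /addv_pi1 daddv_pi_id ?capv_diff ?subvsP // vsvalK.
Qed.

Lemma quot_class_eq0 (V U : {vspace vT}) (v : vT) : (U <= V)%VS -> v \in V ->
  (quot_class V U v == 0) = (v \in U).
Proof.
move=> sUV Vv.
have vE : addv_pi1 V U v + addv_pi2 V U v = v.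
  by rewrite addv_pi1_pi2 // (subvP (addvSl V U)).
have pi2U : addv_pi2 V U v \in U by exact: memv_pi2.
rewrite lfunE /= -(inj_eq val_inj) /= vsprojK ?memv_pi //.
apply/eqP/idP => [e0 | Uv]; first by rewrite -vE e0 add0r.
have pi1U : addv_pi1 V U v \in U.
  by rewrite -(addrK (addv_pi2 V U v) (addv_pi1 V U v)) vE rpredB.
have : addv_pi1 V U v \in ((V :\: U) :&: U)%VS by rewrite memv_cap memv_pi pi1U.
by rewrite capv_diff memv0 => /eqP.
Qed.

Lemma quot_map_class (V U : {vspace vT}) (f : 'End(vT)) (v : vT) :
    (U <= V)%VS -> (f @: V <= V)%VS -> (f @: U <= U)%VS -> v \in V ->
  quot_map V U f (quot_class V U v) = quot_class V U (f v).
Proof.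
move=> sUV fV fU Vv; rewrite lfunE /=.
set w := vsval _.
have Vw : w \in V by rewrite (subvP (diffvSl V U)) // subvsP.
have cw : quot_class V U w = quot_class V U v.
  rewrite {1}/quot_class lfunE /= /addv_pi1 daddv_pi_id ?capv_diff ?subvsP //.
  by rewrite vsvalK.
have Uwv : w - v \in U by rewrite -(quot_class_eq0 sUV) ?rpredB // linearB /= cw subrr.
have Vf u : u \in V -> f u \in V by move=> /(memv_img f); exact: (subvP fV).
have Vfwv : f w - f v \in V by rewrite rpredB ?Vf.
apply/eqP; rewrite -subr_eq0 -linearB /= quot_class_eq0 // -linearB.
by rewrite (subvP fU) // memv_img.
Qed.

End LinearAlgebra.

Record sgraph := SGraph {
  vert :> finType;
  adj : rel vert;
  adj_sym : symmetric adj;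
  adj_irrefl : irreflexive adj
}.

Section Complement.
Variable G : sgraph.

Definition compl_adj : rel G := [rel x y | (x != y) && ~~ adj x y].

Fact compl_adj_sym : symmetric compl_adj.
Proof. by move=> x y; rewrite /compl_adj /= eq_sym adj_sym. Qed.

Fact compl_adj_irrefl : irreflexive compl_adj.
Proof. by move=> x; rewrite /compl_adj /= eqxx. Qed.

Definition compl : sgraph := SGraph compl_adj_sym compl_adj_irrefl.

End Complement.

Section Cycle.
Variable n : nat.

(* ordS i is i + 1 modulo n; the condition i != j matters only for n = 1.     *)
Definition cycle_adj : rel 'I_n :=
  [rel i j | (i != j) && ((j == ordS i) || (i == ordS j))].

Fact cycle_adj_sym : symmetric cycle_adj.
Proof. by move=> i j; rewrite /cycle_adj /= eq_sym orbC. Qed.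

Fact cycle_adj_irrefl : irreflexive cycle_adj.
Proof. by move=> i; rewrite /cycle_adj /= eqxx. Qed.

Definition cycle_graph : sgraph := SGraph cycle_adj_sym cycle_adj_irrefl.

End Cycle.

Definition Aut_graph (G : sgraph) : {set {perm G}} :=
  [set T : {perm G} | [forall x, forall y, adj (T x) (T y) == adj x y]].

Section Cohomology.
Variables (R : realType) (G : sgraph).

Definition vtuple (k : nat) := {ffun 'I_k.+1 -> G}.

(* x lists, in some order, the k + 1 vertices of a k-simplex of the Whitney   *)
(* complex; irreflexivity of adj forces the x i to be distinct.               *)
Definition ordered_simplex k (x : vtuple k) : bool :=
  [forall i, forall j, (i != j) ==> adj (x i) (x j)].

Definition face k (x : vtuple k.+1) (i : 'I_k.+2) : vtuple k :=
  [ffun j => x (lift i j)].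

Definition reorder k (x : vtuple k) (s : 'S_k.+1) : vtuple k :=
  [ffun i => x (s i)].

Local Notation vfun k := {ffun vtuple k -> R^o}.

Definition eval_at k (x : vtuple k) (f : vfun k) : R^o := f x.

Definition alt_defect k (x : vtuple k) (s : 'S_k.+1) (f : vfun k) : R^o :=
  f (reorder x s) - (-1) ^+ s * f x.

(* The k-cochains: alternating functions on ordered k-simplices, extended by  *)
(* zero to all tuples of vertices, see cochainsP.                             *)
Definition cochains k : {vspace vfun k} :=
  ((\bigcap_(x : vtuple k | ~~ ordered_simplex x) lker (linfun (eval_at x)))
   :&: (\bigcap_(x : vtuple k) \bigcap_(s : 'S_k.+1)
          lker (linfun (alt_defect x s))))%VS.

Definition coboundary_fun k (f : vfun k) : vfun k.+1 :=
  [ffun x => if ordered_simplex x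
             then \sum_(i < k.+2) (-1) ^+ i * f (face x i) else 0].

Definition pullback_fun (T : {perm G}) k (f : vfun k) : vfun k :=
  [ffun x : vtuple k => f [ffun i => T (x i)]].

Fact vfunE k (a : R) (f g : vfun k) x : (a *: f + g) x = a * f x + g x.
Proof. by rewrite !ffunE. Qed.

Fact eval_at_linear k x : linear (@eval_at k x).
Proof. by move=> a f g; rewrite /eval_at vfunE. Qed.
HB.instance Definition _ k x :=
  GRing.isLinear.Build R (vfun k) R^o _ (@eval_at k x) (@eval_at_linear k x).

Fact alt_defect_linear k x s : linear (@alt_defect k x s).
Proof.
move=> a f g; rewrite /alt_defect !vfunE /=.
by rewrite [a *: _]mulrBr [in LHS]mulrDr opprD addrACA mulrCA.
Qed.
HB.instance Definition _ k x s :=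
  GRing.isLinear.Build R (vfun k) R^o _ (@alt_defect k x s)
    (@alt_defect_linear k x s).

Fact coboundary_linear k : linear (@coboundary_fun k).
Proof.
move=> a f g; apply/ffunP => x; rewrite vfunE !ffunE.
case: ifP => _; last by rewrite mulr0 addr0.
rewrite mulr_sumr -big_split /=; apply: eq_bigr => i _.
by rewrite vfunE mulrDr mulrCA.
Qed.
HB.instance Definition _ k :=
  GRing.isLinear.Build R (vfun k) (vfun k.+1) _ (@coboundary_fun k)
    (@coboundary_linear k).

Fact pullback_linear T k : linear (@pullback_fun T k).
Proof. by move=> a f g; apply/ffunP => x; rewrite vfunE !ffunE. Qed.
HB.instance Definition _ T k :=
  GRing.isLinear.Build R (vfun k) (vfun k) _ (@pullback_fun T k)
    (@pullback_linear T k).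

Lemma cochainsP k (f : vfun k) :
  reflect ((forall x, ~~ ordered_simplex x -> f x = 0) /\
           (forall x (s : 'S_k.+1), f (reorder x s) = (-1) ^+ s * f x))
          (f \in cochains k).
Proof.
rewrite memv_cap; apply: (iffP andP) => -[h1 h2]; split.
- move=> x nx; have /subv_bigcapP/(_ x nx) := h1.
  by rewrite -memvE memv_ker lfunE => /eqP.
- move=> x s; have /subv_bigcapP/(_ x isT)/subv_bigcapP/(_ s isT) := h2.
  by rewrite -memvE memv_ker lfunE subr_eq0 => /eqP.
- by apply/subv_bigcapP => x nx; rewrite -memvE memv_ker lfunE; apply/eqP/h1.
- apply/subv_bigcapP => x _; apply/subv_bigcapP => s _.
  by rewrite -memvE memv_ker lfunE subr_eq0; apply/eqP/h2.
Qed.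

Definition coboundary k : 'Hom(vfun k, vfun k.+1) := linfun (@coboundary_fun k).

Definition pullback (T : {perm G}) k : 'End(vfun k) :=
  linfun (@pullback_fun T k).

Definition cocycles k : {vspace vfun k} :=
  (cochains k :&: lker (coboundary k))%VS.

Definition coboundaries k : {vspace vfun k} :=
  if k is k'.+1 then (coboundary k' @: cochains k')%VS else 0%VS.

Definition cohomology k := quotv (cocycles k) (coboundaries k).

HB.instance Definition _ k := Vector.on (cohomology k).

Definition cohomology_map (T : {perm G}) k : 'End(cohomology k) :=
  quot_map (cocycles k) (coboundaries k) (pullback T k).

(* There are no k-simplices, hence no cohomology, for k >= #|G|.              *)
Definition lefschetz (T : {perm G}) : R :=
  \sum_(k < #|G|) (-1) ^+ k * lftrace (cohomology_map T k).

Definition lefschetz_numbers : set R :=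
  [set r | exists2 T, T \in Aut_graph G & lefschetz T = r]%classic.

Definition average_lefschetz : R :=
  (\sum_(T in Aut_graph G) lefschetz T) / #|Aut_graph G|%:R.

End Cohomology.

Arguments lefschetz_numbers R G : clear implicits.

(* Main.v *)
From HB Require Import structures.
Require Import Defs.
From mathcomp Require Import classical_sets reals.
From mathcomp Require Import all_boot all_order all_algebra all_fingroup.
From mathcomp Require Import zify ring.

(** On the chain level the Lefschetz number becomes a finite count. The trace
of T on cohomology is, by rank-nullity and telescoping, the alternating sum of
its traces on cochains ([hopf_trace]). The trace on k-cochains only sees the
cliques A with T A = A, and each contributes the sign of T on A. As that sign
is (-1) to the power #A + (number of orbits of T in A), the dimension of the
simplex cancels and [lefschetz_cliques] gives
  chi(G, T) = 1 - S(T),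
where S(T) is the sum of (-1)^(number of T-orbits in A) over all T-stable
cliques A, the empty one included.

Cliques of the complement of C_n are the sets without two cyclically
consecutive vertices. Hence S(T) is the independence polynomial at -1 of the
quotient of C_n by the orbits of T, an orbit that contains two neighbours being
a vertex with a loop ([stable_clique_sum_quotient]). For the rotation by a the
quotient is a cycle of length gcd(n, a). For a reflection it is a path, with a
loop at each end at which the axis crosses an edge. Adding one vertex acts on
these sums by a 2 x 2 matrix M with M^3 = -1 ([transfer_add3]), so they have
period 6 in the length of the cycle or path. The length of the path is about
n / 2, which accounts for the period 12; the rotations depend only on
gcd(n, 6).

The automorphism group consists of n rotations and n reflections ([big_aut]).
Over the rotations S(T) sums to n if n is prime to 6 and to 0 otherwise.
Over the reflections the two types cancel if n is even, while for odd n all n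
reflections are conjugate and share one value, which is 1, 0 or -1 according to
n modulo 12. The total is 2 n exactly when n is 1 or 11 modulo 12, where the
average is 1 - 1 = 0, and it is 0 otherwise ([total_sum]). *)

Set Implicit Arguments.
Unset Strict Implicit.
Unset Printing Implicit Defensive.

Import GRing.Theory Num.Theory passmx.
Local Open Scope ring_scope.

(** * Traces on invariant subspaces *)

Section Trace.
Variable F : fieldType.

(** All trace identities below come from this one: factors are rotated
until a projection meets a map that already lands in its image and is absorbed,
so that no bases have to be adapted to subspaces. *)
Lemma lftraceC (U V : vectType F) (f : 'Hom(U, V)) (g : 'Hom(V, U)) :
  lftrace (f \o g)%VF = lftrace (g \o f)%VF.
Proof.
by rewrite /lftrace !(mxof_comp _ _ (vbasisP _)) mxtrace_mulC.
Qed.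

Lemma lftraceD (V : vectType F) (f g : 'End(V)) :
  lftrace (f + g) = lftrace f + lftrace g.
Proof. by rewrite /lftrace linearD mxtraceD. Qed.

Lemma lftrace_sum (V : vectType F) (I : finType) (f : I -> 'End(V)) :
  lftrace (\sum_i f i) = \sum_i lftrace (f i).
Proof. by rewrite /lftrace !linear_sum. Qed.

Lemma lftrace_line (f : 'End(F^o)) : lftrace f = f 1.
Proof.
have -> : f = f 1 *: \1%VF.
  apply/lfunP => x; rewrite scale_lfunE id_lfunE -[x in LHS]mulr1.
  by rewrite [x * 1](_ : _ = x *: (1 : F^o)) // linearZ /= /GRing.scale /= mulrC.
rewrite /lftrace linearZ /= mxof1 ?(basis_free (vbasisP _)) // mxtraceZ mxtrace1.
rewrite scale_lfunE id_lfunE dimvf.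
by rewrite [RHS](_ : _ = f 1 * 1).
Qed.

(** For f-stable U this is the trace of the restriction of f to U, expressed
without leaving End(V): restrict along a projection onto U. *)
Definition lftrace_on (V : vectType F) (U : {vspace V}) (f : 'End(V)) : F :=
  lftrace (f \o projv U)%VF.

(** The trace on U can be computed with any projection onto U, not only the one
along a fixed complement; quotients, kernels and the
alternating cochains all come with projections of their own. *)
Lemma lftrace_on_proj (V : vectType F) (U : {vspace V}) (f p : 'End(V)) :
  (f @: U <= U)%VS -> (forall x, p x \in U) -> {in U, forall x, p x = x} ->
  lftrace (f \o p)%VF = lftrace_on U f.
Proof.
move=> fU pU pid.
have fU' x : x \in U -> f x \in U by move=> /(memv_img f); apply: (subvP fU).
have -> : (f \o p = projv U \o (f \o p))%VF.
  by apply/lfunP => x; rewrite !comp_lfunE projv_id // fU'.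
rewrite lftraceC -comp_lfunA; congr lftrace; apply/lfunP => x.
by rewrite !comp_lfunE pid // memv_proj.
Qed.

Lemma lftrace_on0 (V : vectType F) (f : 'End(V)) : lftrace_on 0%VS f = 0.
Proof.
have p0 : projv 0%VS = 0 :> 'End(V).
  by apply/lfunP => x; apply/eqP; rewrite zero_lfunE -memv0 memv_proj.
by rewrite /lftrace_on /lftrace p0 comp_lfun0r linear0 mxtrace0.
Qed.

Lemma lftrace_comp_proj (V : vectType F) (U : {vspace V}) (f q : 'End(V)) :
  (f @: U <= U)%VS -> (forall x, q x \in U) ->
  lftrace (f \o q)%VF = lftrace (f \o (q \o projv U))%VF.
Proof.
move=> fU qU; have -> : (f \o q = projv U \o (f \o q))%VF.
  apply/lfunP => x; rewrite !comp_lfunE.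
  by rewrite (projv_id (subvP fU _ (memv_img f (qU x)))).
by rewrite [LHS]lftraceC comp_lfunA.
Qed.

(** The two components of the decomposition of Z along B are projections onto the
complement of B in Z and onto B; the former carries the quotient map. *)
Lemma lftrace_on_quot (V : vectType F) (Z B : {vspace V}) (f : 'End(V)) :
  (B <= Z)%VS -> (f @: Z <= Z)%VS -> (f @: B <= B)%VS ->
  lftrace (quot_map Z B f) = lftrace_on Z f - lftrace_on B f.
Proof.
move=> sBZ fZ fB.
pose iota : 'Hom(quotv Z B, V) := linfun vsval.
have -> : quot_map Z B f = (quot_class Z B \o (f \o iota))%VF.
  by apply/lfunP => x; rewrite lfunE /= !comp_lfunE [iota x]lfunE.
rewrite lftraceC -comp_lfunA.
have -> : (iota \o quot_class Z B)%VF = addv_pi1 Z B.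
  by apply/lfunP => x; rewrite comp_lfunE !lfunE /= vsprojK // memv_pi.
have pi1Z x : addv_pi1 Z B x \in Z by exact: memv_pi1.
rewrite (lftrace_comp_proj fZ pi1Z).
rewrite -(@lftrace_on_proj _ B f (addv_pi2 Z B \o projv Z)%VF) //.
- apply/(canRL (addrK _)); rewrite -lftraceD -comp_lfunDr -comp_lfunDl.
  congr (lftrace (f \o _)%VF); apply/lfunP => x; rewrite comp_lfunE add_lfunE.
  by rewrite addv_pi1_pi2 // (addv_idPl sBZ) memv_proj.
- by move=> x; rewrite comp_lfunE memv_pi2.
- by move=> x Bx; rewrite comp_lfunE (projv_id (subvP sBZ _ Bx)) addv_pi2_id.
Qed.

Lemma lftrace_on_rank_nullity (V W : vectType F) (d : 'Hom(V, W)) (C : {vspace V})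
    (f : 'End(V)) (g : 'End(W)) :
  (f @: C <= C)%VS -> {in C, forall x, d (f x) = g (d x)} ->
  lftrace_on C f = lftrace_on (C :&: lker d)%VS f + lftrace_on (d @: C)%VS g.
Proof.
move=> fC dfg.
have fC' x : x \in C -> f x \in C by move=> /(memv_img f); apply: (subvP fC).
(* s is a section of d over d C with values in C: the pseudo-inverse of d p
   alone could leave C. *)
pose p := projv C; pose dp := (d \o p)%VF; pose s := (p \o dp^-1)%VF.
have sC y : s y \in C by rewrite comp_lfunE memv_proj.
have dpC x : dp x \in (d @: C)%VS by rewrite comp_lfunE memv_img ?memv_proj.
have ds y : y \in (d @: C)%VS -> d (s y) = y.
  move=> dCy; rewrite comp_lfunE -[d (p _)]comp_lfunE limg_lfunVK //.
  by rewrite limg_comp limg_proj.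
(* p - s d p projects onto C :&: lker d, and s d p carries the trace on d C. *)
rewrite -(@lftrace_on_proj _ (C :&: lker d)%VS f (p - (s \o dp))%VF).
- rewrite /lftrace_on -/p -[in LHS](subrK (s \o dp)%VF p) comp_lfunDr lftraceD.
  congr (_ + _).
  have -> : (f \o (s \o dp) = (f \o s \o projv (d @: C)) \o dp)%VF.
    by apply/lfunP => x; move: (projv_id (dpC x)); rewrite !comp_lfunE => ->.
  rewrite lftraceC; congr lftrace; apply/lfunP => y.
  have zB := memv_proj (d @: C)%VS y.
  rewrite [LHS](_ : _ = dp (f (s (projv (d @: C) y)))) ?[RHS]comp_lfunE; last first.
    by rewrite !comp_lfunE.
  rewrite [dp _]comp_lfunE /p (projv_id (fC' _ (sC _))).
  by rewrite (dfg _ (sC _)) (ds _ (memv_proj _ _)).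
- apply/subvP => _ /memv_imgP[x /[!memv_cap]/andP[Cx] /[!memv_ker] /eqP dx ->].
  by rewrite fC' //= dfg // dx linear0.
- move=> x; rewrite memv_cap add_lfunE opp_lfunE comp_lfunE.
  rewrite (rpredB (memv_proj _ _) (sC _)) memv_ker linearB /= (ds _ (dpC x)).
  by rewrite comp_lfunE subrr.
- move=> x /[!memv_cap]/andP[Cx] /[!memv_ker] /eqP dx.
  by rewrite add_lfunE opp_lfunE !comp_lfunE (projv_id Cx) dx !linear0 addr0.
Qed.

End Trace.

Section TraceFunctions.
Variables (F : fieldType) (I : finType).

Definition coordinate (x : I) (f : {ffun I -> F^o}) : F^o := f x.
Definition point_mass (x : I) (a : F^o) : {ffun I -> F^o} :=
  [ffun y => a * (y == x)%:R].

Fact coordinate_linear x : linear (coordinate x).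
Proof. by move=> a f g; rewrite /coordinate !ffunE. Qed.
HB.instance Definition _ x :=
  GRing.isLinear.Build F {ffun I -> F^o} F^o _ (coordinate x)
    (coordinate_linear x).

Fact point_mass_linear x : linear (point_mass x).
Proof. by move=> a b c; apply/ffunP => y; rewrite !ffunE mulrDl -scalerAl. Qed.
HB.instance Definition _ x :=
  GRing.isLinear.Build F F^o {ffun I -> F^o} _ (point_mass x)
    (point_mass_linear x).

Lemma lftrace_ffun (f : 'End({ffun I -> F^o})) :
  lftrace f = \sum_x f (point_mass x 1) x.
Proof.
pose e x : 'Hom({ffun I -> F^o}, F^o) := linfun (coordinate x).
pose m x : 'Hom(F^o, {ffun I -> F^o}) := linfun (point_mass x).
have fE : f = \sum_x (f \o (m x \o e x))%VF.
  apply/lfunP => h; rewrite sum_lfunE.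
  under eq_bigr do rewrite !comp_lfunE.
  rewrite -linear_sum; congr (f _); apply/ffunP => y.
  rewrite sum_ffunE (bigD1 y) //= !lfunE /= ffunE eqxx mulr1.
  rewrite [X in _ + X]big1 ?addr0 // => x /negPf xy.
  by rewrite !lfunE /= ffunE eq_sym xy mulr0.
rewrite {1}fE lftrace_sum; apply: eq_bigr => x _.
by rewrite comp_lfunA lftraceC lftrace_line !comp_lfunE !lfunE.
Qed.

End TraceFunctions.

(** * The Hopf trace formula *)

Section Hopf.
Variables (R : realType) (G : sgraph).
Local Notation vfun k := {ffun vtuple G k -> R^o}.

Lemma ordered_simplexP k (x : vtuple G k) :
  reflect (forall i j, i != j -> adj (x i) (x j)) (ordered_simplex x).
Proof.
apply: (iffP forallP) => [h i j ij | h i].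
  by have /forallP/(_ j)/implyP := h i; apply.
by apply/forallP => j; apply/implyP => /h.
Qed.

Lemma ordered_simplex_inj k (x : vtuple G k) : ordered_simplex x -> injective x.
Proof.
move=> /ordered_simplexP sx i j xij; apply/eqP/negP => /negP /sx.
by rewrite xij adj_irrefl.
Qed.

Lemma ordered_simplex_reorder k (x : vtuple G k) (s : 'S_k.+1) :
  ordered_simplex (reorder x s) = ordered_simplex x.
Proof.
apply/ordered_simplexP/ordered_simplexP => h i j ij.
  have := h (s^-1 i)%g (s^-1 j)%g; rewrite !ffunE !permKV; apply.
  by rewrite (inj_eq perm_inj).
by rewrite !ffunE h // (inj_eq perm_inj).
Qed.

Lemma ordered_simplex_face k (x : vtuple G k.+1) i :
  ordered_simplex x -> ordered_simplex (face x i).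
Proof.
move=> /ordered_simplexP h; apply/ordered_simplexP => a b ab.
by rewrite !ffunE h // (inj_eq lift_inj).
Qed.

Lemma coboundaryE k (f : vfun k) x :
  coboundary R G k f x =
  if ordered_simplex x then \sum_(i < k.+2) (-1) ^+ i * f (face x i) else 0.
Proof. by rewrite lfunE /= ffunE. Qed.

Lemma pullbackE (T : {perm G}) k (f : vfun k) x :
  pullback R T k f x = f [ffun i => T (x i)].
Proof. by rewrite lfunE /= ffunE. Qed.

(** Deleting position i after permuting by s is deleting position s i and then
permuting by s'; this is how the coboundary of an alternating cochain is seen
to be alternating. *)
Lemma perm_unlift n (s : 'S_n.+1) (i : 'I_n.+1) :
  exists s', s = lift_perm i (s i) s'.
Proof.
have ne j : s i != s (lift i j) by rewrite (inj_eq perm_inj) neq_lift.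
(* The default j is never reached, by ne. *)
pose f j := if unlift (s i) (s (lift i j)) is Some j' then j' else j.
have fE j : lift (s i) (f j) = s (lift i j).
  by rewrite /f; case: (unlift_some (ne j)) => j' -> ->.
have f_inj : injective f.
  by move=> j j' e; apply: (@lift_inj _ i); apply: (@perm_inj _ s); rewrite -!fE e.
exists (perm f_inj); apply/permP => j.
case: (unliftP i j) => [j' ->|->]; last by rewrite lift_perm_id.
by rewrite lift_perm_lift permE fE.
Qed.

Lemma coboundary_cochains k (f : vfun k) :
  f \in cochains R G k -> coboundary R G k f \in cochains R G k.+1.
Proof.
move=> /cochainsP[f0 fs]; apply/cochainsP; split=> [x /negPf nx | x s].
  by rewrite coboundaryE nx.
rewrite !coboundaryE ordered_simplex_reorder; case: ifP; last by rewrite mulr0.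
move=> _; rewrite mulr_sumr [RHS](reindex_inj (@perm_inj _ s)) /=.
apply: eq_bigr => i _; have [s' sE] := perm_unlift s i.
have -> : face (reorder x s) i = reorder (face x (s i)) s'.
  by apply/ffunP => j; rewrite !ffunE [in LHS]sE lift_perm_lift.
rewrite fs !mulrA; congr (_ * _).
have sgn : (-1) ^+ s = (-1) ^+ i * (-1) ^+ s i * (-1) ^+ s' :> R.
  by rewrite {1}sE odd_lift_perm !signr_addb !signr_odd.
by rewrite sgn [RHS]mulrAC -[X in _ = X * _]mulrA -expr2 sqrr_sign mulr1.
Qed.

Lemma coboundaryK k (f : vfun k) :
  coboundary R G k.+1 (coboundary R G k f) = 0.
Proof.
apply/ffunP => x; rewrite coboundaryE ffunE; case: ifP => // sx.
set S := \sum_i _.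
have SE : S = \sum_(p : 'I_k.+3 * 'I_k.+2)
    (-1) ^+ (p.1 + p.2) * f (face (face x p.1) p.2).
  rewrite -(pair_bigA _ (fun (i : 'I_k.+3) (j : 'I_k.+2) =>
    (-1) ^+ (i + j) * f (face (face x i) j))) /=.
  apply: eq_bigr => i _.
  rewrite coboundaryE ordered_simplex_face // mulr_sumr.
  by apply: eq_bigr => j _; rewrite exprD mulrA.
(* The same two positions can be deleted in either order; h exchanges the two
   orders, and the signs of the two terms are opposite. *)
pose h (p : 'I_k.+3 * 'I_k.+2) : 'I_k.+3 * 'I_k.+2 :=
  (lift p.1 p.2, inord (unbump p.2 p.1)).
have hE p : (h p).2 = unbump p.2 p.1 :> nat.
  rewrite /h /= inordK // /unbump; case: p => [[i /= lti] [j /= ltj]]; lia.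
have hK : involutive h.
  move=> p; case: (p) (hE p) (hE (h p)) => i j /= e1 e2.
  congr pair; apply: val_inj; rewrite /= ?e2 e1 /= /bump /unbump; lia.
have SN : S = - S.
  rewrite {1}SE (reindex_inj (inv_inj hK)) SE -sumrN; apply: eq_bigr => p _.
  have -> : face (face x (h p).1) (h p).2 = face (face x p.1) p.2.
    apply/ffunP => c; rewrite !ffunE; congr (x _); apply: val_inj.
    by rewrite [LHS]/= hE /= [RHS]bumpC.
  rewrite -mulNr; congr (_ * _); rewrite hE /= -signr_odd -[in RHS]signr_odd.
  have -> : odd (bump p.1 p.2 + unbump p.2 p.1) = ~~ odd (p.1 + p.2).
    rewrite /bump /unbump; lia.
  by rewrite signrN.
by apply/eqP; rewrite -eqNr -SN.
Qed.

Lemma ordered_simplex_aut (T : {perm G}) k (x : vtuple G k) :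
  T \in Aut_graph G -> ordered_simplex [ffun i => T (x i)] = ordered_simplex x.
Proof.
move=> /[!inE] /forallP autT.
apply: eq_forallb => i; apply: eq_forallb => j; rewrite !ffunE.
by have /forallP/(_ (x j))/eqP -> := autT (x i).
Qed.

Lemma coboundary_pullback (T : {perm G}) k (f : vfun k) :
  T \in Aut_graph G ->
  coboundary R G k (pullback R T k f) = pullback R T k.+1 (coboundary R G k f).
Proof.
move=> autT; apply/ffunP => x.
rewrite pullbackE !coboundaryE ordered_simplex_aut //.
case: ifP => // _; apply: eq_bigr => i _; rewrite pullbackE.
by congr (_ * f _); apply/ffunP => j; rewrite !ffunE.
Qed.

Lemma pullback_cochains (T : {perm G}) k (f : vfun k) :
  T \in Aut_graph G -> f \in cochains R G k ->
  pullback R T k f \in cochains R G k.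
Proof.
move=> autT /cochainsP[f0 fs].
apply/cochainsP; split=> [x nx | x s]; rewrite !pullbackE.
  by rewrite f0 // ordered_simplex_aut.
by rewrite -fs; congr (f _); apply/ffunP => i; rewrite !ffunE.
Qed.

Lemma cochains_ge k : (#|G| <= k)%N -> cochains R G k = 0%VS.
Proof.
move=> leGk; apply/eqP; rewrite -subv0; apply/subvP => f /cochainsP[f0 _].
rewrite memv0; apply/eqP/ffunP => x; rewrite ffunE f0 //; apply/negP => sx.
have := leq_card _ (ordered_simplex_inj sx); rewrite card_ord; lia.
Qed.

Lemma mem_cocycles k (f : vfun k) :
  (f \in cocycles R G k) = (f \in cochains R G k) && (coboundary R G k f == 0).
Proof. by rewrite memv_cap memv_ker. Qed.

Section Automorphism.
Variable T : {perm G}.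
Hypothesis autT : T \in Aut_graph G.

Lemma coboundaries_sub k : (coboundaries R G k <= cocycles R G k)%VS.
Proof.
case: k => [|k]; first exact: sub0v.
apply/subvP => _ /memv_imgP[f Cf ->]; rewrite mem_cocycles.
by rewrite coboundary_cochains // coboundaryK eqxx.
Qed.

Lemma pullback_cochainsS k : (pullback R T k @: cochains R G k <= cochains R G k)%VS.
Proof. by apply/subvP => _ /memv_imgP[f Cf ->]; apply: pullback_cochains. Qed.

Lemma pullback_cocyclesS k : (pullback R T k @: cocycles R G k <= cocycles R G k)%VS.
Proof.
apply/subvP => _ /memv_imgP[f /[!mem_cocycles]/andP[Cf /eqP df] ->].
by rewrite pullback_cochains //= coboundary_pullback // df linear0.
Qed.

Lemma pullback_coboundariesS k :
  (pullback R T k @: coboundaries R G k <= coboundaries R G k)%VS.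
Proof.
case: k => [|k]; first by rewrite limg0 sub0v.
apply/subvP => _ /memv_imgP[_ /memv_imgP[f Cf ->] ->].
by rewrite -coboundary_pullback // memv_img // pullback_cochains.
Qed.

(** With c, z and b the traces on cochains, cocycles and coboundaries,
c k = z k + b (k + 1) while cohomology contributes z k - b k, so that the
alternating sums agree up to a boundary term, which vanishes because there are
no simplices with more than #|G| vertices. *)
Lemma hopf_trace :
  lefschetz R T =
  \sum_(k < #|G|) (-1) ^+ k * lftrace_on (cochains R G k) (pullback R T k).
Proof.
pose c k := lftrace_on (cochains R G k) (pullback R T k).
pose z k := lftrace_on (cocycles R G k) (pullback R T k).
pose b k := lftrace_on (coboundaries R G k) (pullback R T k).
have cE k : c k = z k + b k.+1.
  rewrite /c (@lftrace_on_rank_nullity _ _ _ (coboundary R G k) _ _ (pullback R T k.+1)) //.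
    exact: pullback_cochainsS.
  by move=> f _; apply: coboundary_pullback.
have telescope m : \sum_(k < m) (-1) ^+ k * (z k - b k) =
    \sum_(k < m) (-1) ^+ k * c k + (-1) ^+ m * b m.
  elim: m => [|m IH]; first by rewrite !big_ord0 /b lftrace_on0 mulr0 addr0.
  by rewrite !big_ord_recr /= IH cE exprS; ring.
have bG : b #|G| = 0.
  have BG : (coboundaries R G #|G| <= 0)%VS.
    rewrite -(cochains_ge (leqnn #|G|)).
    by rewrite (subv_trans (coboundaries_sub _)) ?capvSl.
  by move: BG; rewrite /b subv0 => /eqP ->; rewrite lftrace_on0.
transitivity (\sum_(k < #|G|) (-1) ^+ k * (z k - b k)); last first.
  by rewrite telescope bG mulr0 addr0.
apply: eq_bigr => k _; congr (_ * _).
exact: lftrace_on_quot (coboundaries_sub _) (pullback_cocyclesS _) (pullback_coboundariesS _).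
Qed.

End Automorphism.
End Hopf.

(** * Traces on cochains as signed counts of stable cliques *)

Section Alternation.
Variables (R : realType) (G : sgraph) (k : nat).
Local Notation vfun := {ffun vtuple G k -> R^o}.

(** Averaging over signed reorderings projects onto the alternating cochains, so
the trace on cochains can be computed in the basis of point masses of the
ambient function space; no orientation of the simplices has to be chosen. *)
Definition alternate_fun (f : vfun) : vfun :=
  [ffun x => if ordered_simplex x
             then ((k.+1)`!%:R)^-1 * \sum_(s : 'S_k.+1) (-1) ^+ s * f (reorder x s)
             else 0].

Fact alternate_linear : linear alternate_fun.
Proof.
move=> a f g; apply/ffunP => x; rewrite vfunE !ffunE.
case: ifP => _; last by rewrite mulr0 addr0.
rewrite mulrCA -mulrDr; congr (_ * _).
rewrite mulr_sumr -big_split /=; apply: eq_bigr => i _.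
by rewrite vfunE mulrDr mulrCA.
Qed.
HB.instance Definition _ :=
  GRing.isLinear.Build R vfun vfun _ alternate_fun alternate_linear.

Definition alternate : 'End(vfun) := linfun alternate_fun.

Lemma alternateE f x : alternate f x =
  if ordered_simplex x
  then ((k.+1)`!%:R)^-1 * \sum_(s : 'S_k.+1) (-1) ^+ s * f (reorder x s) else 0.
Proof. by rewrite lfunE /= ffunE. Qed.

Lemma alternate_cochains f : alternate f \in cochains R G k.
Proof.
apply/cochainsP; split=> [x /negPf nx | x t]; first by rewrite alternateE nx.
rewrite !alternateE ordered_simplex_reorder; case: ifP; last by rewrite mulr0.
move=> _; rewrite mulrCA; congr (_ * _); rewrite mulr_sumr.
rewrite [RHS](reindex_inj (mulIg t)) /=; apply: eq_bigr => s _.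
rewrite mulrA; congr (_ * f _).
  by rewrite odd_permM signr_addb mulrCA -signr_addb addbb mulr1.
by apply/ffunP => i; rewrite !ffunE permM.
Qed.

Lemma alternate_id : {in cochains R G k, forall f, alternate f = f}.
Proof.
move=> f /cochainsP[f0 fs]; apply/ffunP => x; rewrite alternateE.
case: ifPn => [_ | /f0 //].
under eq_bigr do rewrite fs mulrA -signr_addb addbb mul1r.
rewrite sumr_const card_Sn -[f x *+ _]mulr_natl mulrA mulVf ?mul1r //.
by rewrite pnatr_eq0 -lt0n fact_gt0.
Qed.

Lemma lftrace_on_cochains (T : {perm G}) : T \in Aut_graph G ->
  lftrace_on (cochains R G k) (pullback R T k) =
  ((k.+1)`!%:R)^-1 * \sum_(x : vtuple G k | ordered_simplex x)
    \sum_(s : 'S_k.+1 | [forall i, T (x (s i)) == x i]) (-1) ^+ s.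
Proof.
move=> autT.
rewrite -(lftrace_on_proj (pullback_cochainsS R autT k) alternate_cochains alternate_id).
rewrite lftrace_ffun mulr_sumr [RHS]big_mkcond /=; apply: eq_bigr => x _.
rewrite comp_lfunE pullbackE alternateE ordered_simplex_aut //.
case: ifP => // _; congr (_ * _); rewrite [RHS]big_mkcond /=.
apply: eq_bigr => s _; rewrite ffunE mul1r.
have -> : (reorder [ffun i => T (x i)] s == x) = [forall i, T (x (s i)) == x i].
  apply/eqP/forallP => [e i | e]; first by rewrite -{2}e !ffunE.
  by apply/ffunP => i; rewrite !ffunE; apply/eqP.
by case: ifP; rewrite ?mulr1 ?mulr0.
Qed.

End Alternation.

Definition clique (G : sgraph) (A : {set G}) : bool :=
  [forall x in A, forall y in A, (x != y) ==> adj x y].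

Definition orbits (T : finType) (p : {perm T}) (A : {set T}) : {set {set T}} :=
  porbit p @: A.

(** The parity of s is m plus its number of cycles, and x carries the
cycles of s to the orbits of p in the image of x (s is conjugate to the inverse
of p there, which has the same orbits). *)
Lemma odd_perm_conj (T : finType) (p : {perm T}) m (x : 'I_m -> T) (s : 'S_m) :
  injective x -> (forall i, p (x (s i)) = x i) ->
  odd_perm s = odd (m + #|orbits p (x @: setT)|).
Proof.
move=> x_inj xs; rewrite /odd_perm /= card_ord oddD; congr (_ (+) odd _).
have xsV i : x (s i) = (p^-1)%g (x i) by rewrite -[in RHS]xs permK.
have im i : x @: porbit s i = porbit p (x i).
  rewrite -(porbitV p); apply/setP => y; apply/imsetP/porbitP.
    move=> [_ /porbitP[n ->] ->]; exists n.
    by elim: n => [|n IH]; rewrite ?expg0 ?perm1 // !expgSr !permM xsV IH.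
  move=> [n ->]; exists ((s ^+ n)%g i); first exact: mem_porbit.
  by elim: n => [|n IH]; rewrite ?expg0 ?perm1 // !expgSr !permM xsV IH.
rewrite -(card_imset _ (imset_inj x_inj)); congr #|pred_of_set _|.
apply/setP => A; apply/imsetP/imsetP => [[_ /imsetP[i _ ->] ->] | [_ /imsetP[i _ ->] ->]].
  by exists (x i); rewrite ?imset_f ?inE.
by exists (porbit s i); rewrite ?imset_f ?inE.
Qed.

Section Cliques.
Variables (R : realType) (G : sgraph).

Lemma ordered_simplex_clique k (x : vtuple G k) :
  ordered_simplex x = injectiveb x && clique (x @: setT).
Proof.
apply/idP/andP => [sx | [/injectiveP x_inj /forall_inP cl]].
  split; first exact/injectiveP/ordered_simplex_inj.
  apply/forall_inP => _ /imsetP[i _ ->]; apply/forall_inP => _ /imsetP[j _ ->].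
  apply/implyP => xij; move/ordered_simplexP: sx; apply.
  by apply: contraNneq xij => ->.
apply/ordered_simplexP => i j ij.
have /forall_inP/(_ (x j) (imset_f _ (in_setT j)))/implyP := cl _ (imset_f x (in_setT i)).
by apply; rewrite (inj_eq x_inj).
Qed.

Lemma card_ordered_simplex k (A : {set G}) : clique A -> #|A| = k.+1 ->
  #|[pred x : vtuple G k | ordered_simplex x && (x @: setT == A)]| = (k.+1)`!.
Proof.
move=> clA cA; rewrite -ffactnn -[X in (X ^_ _)%N]cA -[X in (_ ^_ X)%N](card_ord k.+1).
rewrite -card_inj_ffuns_on cardsE; apply: eq_card => x.
rewrite !inE ordered_simplex_clique -andbA andbC.
apply/andP/andP => [[/andP[_ /eqP <-] x_inj] | [/ffun_onP xA x_inj]].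
  by split=> //; apply/ffun_onP => i; rewrite imset_f.
suff -> : x @: setT = A by rewrite clA eqxx.
apply/eqP; rewrite eqEcard card_imset; last exact/injectiveP.
rewrite cardsT card_ord cA leqnn andbT.
by apply/subsetP => _ /imsetP[i _ ->].
Qed.

(** An ordering x of a clique can be undone by at most one reordering s after
applying T, and by exactly one if T stabilizes the clique. *)
Lemma sum_stable_orderings k (T : {perm G}) (x : vtuple G k) : injective x ->
  \sum_(s : 'S_k.+1 | [forall i, T (x (s i)) == x i]) (-1) ^+ s =
  if T @: (x @: setT) == x @: setT
  then (-1) ^+ (k.+1 + #|orbits T (x @: setT)|) else 0 :> R.
Proof.
move=> x_inj; case: ifPn => [/eqP Tx | nTx].
  have ex i : exists j, T (x j) == x i.
    have : x i \in T @: (x @: setT) by rewrite Tx imset_f.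
    by case/imsetP => _ /imsetP[j _ ->] ->; exists j.
  pose f i := xchoose (ex i).
  have fE i : T (x (f i)) = x i by apply/eqP/(xchooseP (ex i)).
  have f_inj : injective f.
    by move=> i j fij; apply: x_inj; rewrite -fE fij fE.
  rewrite (big_pred1 (perm f_inj)).
    rewrite -[RHS]signr_odd (@odd_perm_conj _ T _ x _ x_inj) // => i.
    by rewrite permE fE.
  move=> s; apply/forallP/eqP => [sE | -> i]; last by rewrite permE fE.
  apply/permP => i; rewrite permE; apply: x_inj; apply: (@perm_inj _ T).
  by rewrite fE; apply/eqP.
rewrite big_pred0 // => s; apply/negP => /forallP sE; case/negP: nTx.
rewrite eq_sym eqEcard (card_imset _ (@perm_inj _ T)) leqnn andbT.
apply/subsetP => _ /imsetP[i _ ->]; rewrite -(eqP (sE i)).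
by rewrite !imset_f.
Qed.

Lemma lftrace_on_cochains_cliques (T : {perm G}) k : T \in Aut_graph G ->
  lftrace_on (cochains R G k) (pullback R T k) =
  \sum_(A : {set G} | (clique A && (T @: A == A)) && (#|A| == k.+1))
    (-1) ^+ (k.+1 + #|orbits T A|).
Proof.
move=> autT; rewrite lftrace_on_cochains //.
rewrite (partition_big (fun x : vtuple G k => x @: setT)
   (fun A => clique A && (#|A| == k.+1))) /=; last first.
  move=> x sx; have := sx; rewrite ordered_simplex_clique => /andP[_ ->] /=.
  by rewrite card_imset ?cardsT ?card_ord //; apply: ordered_simplex_inj.
rewrite mulr_sumr [RHS](eq_bigl (fun A : {set G} => 
  (clique A && (#|A| == k.+1)) && (T @: A == A))); last first.
  by move=> A; rewrite andbAC.
rewrite [RHS]big_mkcondr; apply: eq_bigr => A /andP[clA /eqP cA].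
rewrite (eq_bigr (fun=> if T @: A == A
    then (-1) ^+ (k.+1 + #|orbits T A|) else 0)); last first.
  move=> x /andP[sx /eqP <-].
  by rewrite sum_stable_orderings //; apply: ordered_simplex_inj.
rewrite sumr_const (card_ordered_simplex clA cA) -[X in _ * X]mulr_natl mulrA mulVf.
  by rewrite mul1r.
by rewrite pnatr_eq0 -lt0n fact_gt0.
Qed.

Definition stable_clique_sum (T : {perm G}) : int :=
  \sum_(A : {set G} | clique A && (T @: A == A)) (-1) ^+ #|orbits T A|.

(** A clique with k + 1 vertices enters with sign (-1)^k from the alternating sum
and (-1)^(k + 1 + number of orbits) from its trace; only the number of orbits
and a global minus sign survive. The leading 1 compensates for the empty
clique, which is not a simplex. *)
Lemma lefschetz_cliques (T : {perm G}) : T \in Aut_graph G ->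
  lefschetz R T = (1 - stable_clique_sum T)%:~R.
Proof.
move=> autT; rewrite hopf_trace //.
rewrite /stable_clique_sum (bigD1 set0) /=; last first.
  rewrite imset0 eqxx andbT; apply/forall_inP => x; by rewrite inE.
rewrite {1}/orbits imset0 cards0 expr0 opprD addrA subrr add0r.
rewrite rmorphN rmorph_sum /=.
rewrite -sumrN; under eq_bigr do rewrite lftrace_on_cochains_cliques // mulr_sumr.
rewrite (exchange_big_dep (fun A : {set G} =>
   clique A && (T @: A == A) && (A != set0))) /=; last first.
  move=> k A _ /andP[-> /eqP cA] /=.
  by rewrite -card_gt0 cA.
apply: eq_bigr => A /andP[/andP[clA TA] A0].
have ltA : (#|A|.-1 < #|G|)%N.
  by rewrite prednK ?card_gt0 // max_card.
rewrite (big_pred1 (Ordinal ltA)) => [|k]; last first.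
  rewrite clA TA /=; apply/eqP/eqP => [cA | ->].
    by apply: val_inj; rewrite /= cA.
  by rewrite /= prednK ?card_gt0.
rewrite rmorphXn rmorphN1 /= addSn exprS exprD mulN1r mulrN mulrA -expr2.
by rewrite sqrr_sign mul1r.
Qed.

End Cliques.

(** * Independent sets of cycles and paths *)

Section Transfer.

Definition compat : rel bool := fun a b => ~~ (a && b).

(** The transfer-matrix recursion for signed independent sets of a path: b tells
whether the vertex before the path is occupied, and t restricts the state in
which the path may end. See [transferE] for the sum it computes. *)
Fixpoint transfer (t : bool -> bool) (q : nat) (b : bool) : int :=
  if q is q'.+1
  then transfer t q' false - (if b then 0 else transfer t q' true)
  else (t b)%:R.

(** The step matrix, with rows (1, -1) and (1, 0), has characteristic
polynomial X^2 - X + 1, which divides X^3 + 1. *)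
Lemma transfer_add3 t q b : transfer t (q + 3) b = - transfer t q b.
Proof. rewrite addn3 /=; case: b; ring. Qed.

Lemma big_tuple_bool q (F : seq bool -> int) :
  \sum_(s : q.+1.-tuple bool) F s =
  \sum_(s : q.-tuple bool) F (false :: s) + \sum_(s : q.-tuple bool) F (true :: s).
Proof.
rewrite (reindex (fun p : bool * q.-tuple bool => [tuple of p.1 :: p.2])) /=.
  rewrite -(pair_bigA _ (fun (b : bool) (s : q.-tuple bool) => F (b :: s))) /=.
  by rewrite big_bool addrC.
exists (fun s : q.+1.-tuple bool => (thead s, [tuple of behead s])) => [[b s] _|s _] /=.
  by rewrite theadE; congr pair; apply: val_inj.
by rewrite [RHS]tuple_eta; apply: val_inj.
Qed.

Lemma transferE t q b :
  transfer t q b = \sum_(s : q.-tuple bool | path compat b s && t (last b s))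
    (-1) ^+ count id s.
Proof.
rewrite big_mkcond /=; elim: q b => [|q IH] b /=.
  rewrite (big_pred1 [tuple]) /= ?tuple0 //; first by case: (t b).
  by move=> s; apply/esym/eqP; rewrite [s]tuple0.
rewrite !IH (big_tuple_bool _ (fun s => if path compat b s && t (last b s)
   then (-1) ^+ count id s else 0)) /=.
rewrite /compat andbF /= andbT; congr (_ + _).
case: b => /=; first by rewrite oppr0 big1.
rewrite -sumrN; apply: eq_bigr => s _; rewrite exprS mulN1r.
by case: ifP; rewrite ?oppr0.
Qed.

(** A cycle is cut at its first vertex, which is both the predecessor of the
remaining path and a constraint on its last vertex. *)
Lemma transfer_cycleE q :
  transfer predT q false - transfer negb q true =
  \sum_(s : q.+1.-tuple bool | path.cycle compat s) (-1) ^+ count id s.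
Proof.
rewrite big_mkcond /= (big_tuple_bool _ (fun s => if path.cycle compat s
   then (-1) ^+ count id s else 0)) /= !transferE !(big_mkcond (fun s => _ && _)) /=.
congr (_ + _).
  apply: eq_bigr => s _; rewrite rcons_path /compat andbF andbT.
  by rewrite -/compat.
rewrite -sumrN; apply: eq_bigr => s _; rewrite rcons_path.
have -> : compat (last true s) true = ~~ last true s by rewrite /compat andbT.
by case: ifP; rewrite ?oppr0 // exprS mulN1r.
Qed.

End Transfer.

Section OrbitQuotient.
Variables (n q : nat) (T : {perm compl (cycle_graph n)}) (pi : 'I_n -> 'I_q).
Hypothesis n_gt1 : (1 < n)%N.
Hypothesis pi_surj : forall c, exists i, pi i = c.
Hypothesis pi_orbit : forall i j, (pi i == pi j) = (j \in porbit T i).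

Lemma clique_compl_cycle (A : {set compl (cycle_graph n)}) :
  clique A = [forall i : 'I_n, ~~ ((i \in A) && (ordS i \in A))].
Proof.
have neS (i : 'I_n) : i != ordS i.
  apply/eqP => /(congr1 val) /= E; have := ltn_ord i.
  rewrite leq_eqVlt => /orP[/eqP S|S]; move: E; last by rewrite modn_small //; lia.
  rewrite S modnn; lia.
apply/forall_inP/forallP => [cl i | ind i Ai].
  apply/andP => -[Ai ASi]; have /forall_inP/(_ _ ASi) := cl i Ai.
  by rewrite neS /= /compl_adj /= /cycle_adj /= neS eqxx.
apply/forall_inP => j Aj; apply/implyP => ij; rewrite /= /compl_adj /= /cycle_adj /= ij /= negb_or.
apply/andP; split; apply/eqP => E.
  by have := ind i; rewrite -E Ai Aj.
by have := ind j; rewrite -E Ai Aj.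
Qed.

(** The fibres of pi are the T-orbits, so T-stable sets are the unions of fibres
and are encoded by the bit sequences s indexed by the orbits. *)
Lemma stable_clique_sum_quotient :
  stable_clique_sum T =
  \sum_(s : q.-tuple bool |
        [forall i : 'I_n, compat (tnth s (pi i)) (tnth s (pi (ordS i)))])
    (-1) ^+ count id s.
Proof.
pose lift (s : q.-tuple bool) : {set compl (cycle_graph n)} :=
  [set i | tnth s (pi i)].
pose proj (A : {set compl (cycle_graph n)}) : q.-tuple bool :=
  [tuple [exists i : 'I_n, (pi i == c) && (i \in A)] | c < q].
have liftK s : proj (lift s) = s.
  apply: eq_from_tnth => c; rewrite tnth_mktuple.
  apply/existsP/idP => [[i /andP[/eqP <-]] | sc]; first by rewrite inE.
  by have [i pic] := pi_surj c; exists i; rewrite pic eqxx inE pic.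
have piT i : pi (T i) = pi i by apply/eqP; rewrite eq_sym pi_orbit -{1}[T]expg1 mem_porbit.
rewrite /stable_clique_sum (reindex_onto lift proj) /=; last first.
  move=> A /andP[_ /eqP TA]; apply/setP => i; rewrite inE tnth_mktuple.
  apply/existsP/idP => [[j /andP[]] | Ai]; last by exists i; rewrite eqxx.
  rewrite pi_orbit => /porbitP[k ->] Aj; elim: k => [|k IH].
    by rewrite expg0 perm1.
  by rewrite expgSr permM -TA imset_f.
apply: eq_big => [s | s _].
  rewrite liftK eqxx andbT clique_compl_cycle.
  have -> : T @: lift s == lift s.
    rewrite eqEcard (card_imset _ (@perm_inj _ T)) leqnn andbT.
    by apply/subsetP => _ /imsetP[i si ->]; move: si; rewrite !inE piT.
  by rewrite andbT; apply: eq_forallb => i; rewrite !inE.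
congr (_ ^+ _).
pose fib c : {set compl (cycle_graph n)} := [set i | pi i == c].
have fib_inj : injective fib.
  move=> c c'; have [i <-] := pi_surj c => /setP/(_ i).
  by rewrite !inE eqxx => /esym/eqP.
have -> : orbits T (lift s) = fib @: [set c | tnth s c].
  have fibE i : porbit T i = fib (pi i).
    by apply/setP => j; rewrite inE eq_sym pi_orbit.
  apply/setP => A; apply/imsetP/imsetP => [[i + ->] | [c + ->]].
    by rewrite inE => si; exists (pi i); rewrite ?inE ?fibE.
  have [i <-] := pi_surj c; rewrite inE => si.
  by exists i; rewrite ?inE ?fibE.
rewrite card_imset // -[in RHS](map_tnth_enum s) count_map -sum1_count -sum1_card.
rewrite big_enum_cond; apply: eq_bigl => c; by rewrite inE.
Qed.

End OrbitQuotient.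

(** * Rotations and reflections of the cycle *)

Lemma val_ordS n (i : 'I_n) : ordS i = (if i.+1 == n then 0 else i.+1)%N :> nat.
Proof.
rewrite /=; have := ltn_ord i; case: eqP => [->|ne lti]; first by rewrite modnn.
by rewrite modn_small //; lia.
Qed.

(** A loop at the first vertex is encoded by b, an occupied virtual predecessor,
and a loop at the last vertex by the final condition e. *)
Lemma path_compatP q (b e : bool) (s : q.+1.-tuple bool) :
  reflect [/\ b -> ~~ nth false s 0,
              forall c, (c < q)%N -> compat (nth false s c) (nth false s c.+1)
            & e -> ~~ nth false s q]
    (path compat b s && ~~ (e && last b s)).
Proof.
case: s => -[|a s] //= /eqP [sq].
rewrite -[X in last _ X]/(behead (a :: s)) (last_nth false) sq negb_and -andbA.
apply: (iffP and3P) => [[ba /(pathP false) pth l] | [ba pth l]]; split.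
- by move: ba; rewrite /compat; case: (b).
- by move=> c ltc; apply: pth; rewrite sq.
- by move: l; case: (e) => //=; rewrite -sq.
- by move: ba; rewrite /compat; case: (b) => //= ->.
- by apply/(pathP false) => c; rewrite sq => /pth.
- by move: l; case: (e) => //=; rewrite -sq; apply.
Qed.

Lemma cycle_compatP q (s : q.+1.-tuple bool) :
  reflect (forall c, (c < q.+1)%N ->
             compat (nth false s c) (nth false s (c.+1 %% q.+1)))
    (path.cycle compat s).
Proof.
case: s => -[|a s] //= /eqP [sq].
have nE c : (c <= q)%N -> nth false (rcons s a) c = nth false (a :: s) (c.+1 %% q.+1).
  rewrite nth_rcons sq leq_eqVlt => /orP[/eqP ->|ltc].
    by rewrite ltnn eqxx modnn.
  by rewrite ltc modn_small.
have nE' c : (c <= q)%N -> nth false (a :: rcons s a) c = nth false (a :: s) c.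
  by case: c => // c ltc /=; rewrite nth_rcons sq ltc.
apply: (iffP (pathP false)) => h c; rewrite ?size_rcons ?sq => ltc.
  by rewrite -nE // -nE' //; apply: h; rewrite size_rcons sq.
by rewrite nE // nE' //; apply: h.
Qed.

(** The case where the orbit quotient of the cycle is a path on 0, ..., q, with a
loop at 0 if b holds and a loop at q if e holds. *)
Lemma stable_clique_sum_path n q (T : {perm compl (cycle_graph n)})
    (pi : 'I_n -> nat) (b e : bool) :
  (1 < n)%N -> (forall i, pi i <= q)%N ->
  (forall c, (c <= q)%N -> exists i, pi i = c) ->
  (forall i j, (pi i == pi j) = (j \in porbit T i)) ->
  (forall i, [\/ pi (ordS i) = (pi i).+1, pi i = (pi (ordS i)).+1,
     [/\ b, pi i = 0%N & pi (ordS i) = 0%N] | [/\ e, pi i = q & pi (ordS i) = q]]) ->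
  (forall c, (c < q)%N -> exists i, (pi i = c) /\ (pi (ordS i) = c.+1)) ->
  (b -> exists i, (pi i = 0%N) /\ (pi (ordS i) = 0%N)) ->
  (e -> exists i, (pi i = q) /\ (pi (ordS i) = q)) ->
  stable_clique_sum T = transfer (fun x => ~~ (e && x)) q.+1 b.
Proof.
move=> n1 pi_le pi_surj pi_orb H1 H2 H3 H4.
pose pi' i : 'I_q.+1 := inord (pi i).
have pi'E i : pi' i = pi i :> nat by rewrite inordK // ltnS.
rewrite (@stable_clique_sum_quotient n q.+1 T pi') //; last first.
- by move=> i j; rewrite -val_eqE /= !pi'E.
- move=> c; have [i ic] := pi_surj c (ltn_ord c).
  by exists i; apply: val_inj; rewrite /= pi'E.
rewrite transferE; apply: eq_bigl => s.
apply/forallP/path_compatP => [h | [hb hc he] i].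
  split=> [/H3[i [i0 i1]] | c /H2[i [<- <-]] | /H4[i [i0 i1]]].
  - by have := h i; rewrite !(tnth_nth false) !pi'E i0 i1 /compat andbb.
  - by have := h i; rewrite !(tnth_nth false) !pi'E.
  - by have := h i; rewrite !(tnth_nth false) !pi'E i0 i1 /compat andbb.
rewrite !(tnth_nth false) !pi'E.
have [E | E | [/hb ? -> ->] | [/he ? -> ->]] := H1 i; rewrite /compat ?andbb //.
  by rewrite E; apply: hc; rewrite -ltnS -E ltnS.
by rewrite E andbC; apply: hc; rewrite -ltnS -E ltnS.
Qed.

Section Dihedral.
Variable p : nat.
Local Notation n := p.+2.
Implicit Types a i j t : 'I_n.

Lemma ordS_add1 i : ordS i = i + 1.
Proof. by apply: val_inj; rewrite /= modnDmr addn1. Qed.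

Lemma rev_ordE i : rev_ord i = - 1 - i.
Proof.
apply/eqP; rewrite -opprD -addr_eq0 [1 + i]addrC -ordS_add1.
by apply/eqP/val_inj; rewrite /= modnDmr subnK ?modnn.
Qed.

Definition rotation a : {perm compl (cycle_graph n)} := perm (@addrI _ a).
Definition reflection a : {perm compl (cycle_graph n)} := perm (@subrI _ a).

(** By Bezout, the multiples of a modulo n are the multiples of gcd(n, a). *)
Lemma mem_porbit_rotation a i j :
  (j \in porbit (rotation a) i) = (i == j %[mod gcdn n a]).
Proof.
have rotX k : val ((rotation a ^+ k)%g i) = ((i + k * a) %% n)%N.
  elim: k => [|k IH]; first by rewrite expg0 perm1 addn0 modn_small.
  rewrite expgSr permM permE /= IH modnDmr; congr (_ %% _)%N; lia.
apply/porbitP/eqP => [[k ->] | ij].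
  rewrite rotX (modn_dvdm _ (dvdn_gcdl _ _)) -modnDmr.
  by rewrite (eqP (dvdn_mull k (dvdn_gcdr n a))) addn0.
have [u _ /dvdnP[v nv]] := @Bezoutl n a isT.
have /dvdnP[w dw] : (gcdn n a %| i + n - j)%N.
  rewrite -eqn_mod_dvd; last by have := ltn_ord j; lia.
  by rewrite -modnDmr (eqP (dvdn_gcdl n a)) addn0 ij.
exists (u * w)%N; apply: val_inj; rewrite rotX.
have E : (i + u * w * a + n = j + v * w * n)%N.
  have ltj := ltn_ord j.
  have : ((gcdn n a + u * a) * w = v * n * w)%N by rewrite nv.
  rewrite mulnDl -[(gcdn n a * w)%N]mulnC -dw => {}E; nia.
by rewrite -modnDr E addnC modnMDl modn_small.
Qed.

Lemma stable_clique_sum_rotation a :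
  stable_clique_sum (rotation a) =
  transfer predT (gcdn n a).-1 false - transfer negb (gcdn n a).-1 true.
Proof.
have d_gt0 : (0 < gcdn n a)%N by rewrite gcdn_gt0.
case d_eq : (gcdn n a) d_gt0 => [//|q] _ /=.
pose pi i : 'I_q.+1 := inord (i %% q.+1).
have piE i : pi i = (i %% q.+1)%N :> nat by rewrite inordK // ltn_mod.
have q_n : (q.+1 %| n)%N by rewrite -d_eq dvdn_gcdl.
rewrite (@stable_clique_sum_quotient n q.+1 (rotation a) pi) //; last first.
- by move=> i j; rewrite mem_porbit_rotation d_eq -val_eqE /= !piE.
- move=> c; have ltc : (c < n)%N by apply: leq_trans (ltn_ord c) (dvdn_leq _ q_n).
  by exists (Ordinal ltc); apply: val_inj; rewrite /= piE /= modn_small.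
rewrite transfer_cycleE; apply: eq_bigl => s.
have piS i : pi (ordS i) = ((i %% q.+1).+1 %% q.+1)%N :> nat.
  by rewrite piE /= modn_dvdm // -[in RHS]addn1 modnDml addn1.
apply/forallP/cycle_compatP => [h c ltc | h i].
  have ltcn : (c < n)%N by apply: leq_trans ltc (dvdn_leq _ q_n).
  have := h (Ordinal ltcn); rewrite !(tnth_nth false) piS piE /=.
  by rewrite modn_small.
by rewrite !(tnth_nth false) piS piE; apply: h; rewrite ltn_mod.
Qed.

Lemma mem_porbit_reflection a i j :
  (j \in porbit (reflection a) i) = (j == i) || (j == a - i).
Proof.
have reflK k : (reflection a ^+ k)%g i = if odd k then a - i else i.
  elim: k => [|k IH]; first by rewrite expg0 perm1.
  by rewrite expgSr permM IH permE /=; case: (odd k); rewrite ?subKr.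
apply/porbitP/orP => [[k ->] | [/eqP -> | /eqP ->]].
- by rewrite reflK; case: (odd k); rewrite eqxx; [right | left].
- by exists 0%N; rewrite reflK.
- by exists 1%N; rewrite reflK.
Qed.

(** The reflection fixes the vertex - t, and the orbit of i is determined by the
cyclic distance from i to - t. For even n the opposite vertex is fixed as well;
for odd n the axis leaves through an edge, whence a loop at the far end. *)
Lemma stable_clique_sum_reflection_vertex t :
  stable_clique_sum (reflection (- (t + t))) =
  transfer (fun x => ~~ (odd n && x)) n./2.+1 false.
Proof.
pose pi i : nat := minn (i + t)%R (n - (i + t)%R).
have shift (P : 'I_n -> Prop) : (exists j, P j) -> exists i, P (i + t).
  by move=> [j Pj]; exists (j - t); rewrite subrK.
have ordSD i : ordS i + t = ordS (i + t) by rewrite !ordS_add1 addrAC.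
apply: (@stable_clique_sum_path n n./2 _ pi) => //.
- by move=> i; rewrite /pi; have := ltn_ord (i + t); lia.
- move=> c le_c; apply: (shift (fun j => minn j (n - j) = c)).
  have ltc : (c < n)%N by lia.
  by exists (Ordinal ltc) => /=; lia.
- move=> i j; rewrite mem_porbit_reflection.
  have -> : (j == - (t + t) - i) = (j + t == - (i + t)).
    rewrite -(inj_eq (@addIr _ t)); congr (_ == _); ring.
  rewrite -(inj_eq (@addIr _ t)) /pi; move: (i + t) (j + t) => u v.
  rewrite -!val_eqE /=; have := ltn_ord u; have := ltn_ord v.
  case: (posnP u) => [-> | u0 ltv ltu].
    by rewrite subn0 modnn orbb; lia.
  rewrite modn_small; lia.
- move=> i; rewrite /pi ordSD val_ordS; have := ltn_ord (i + t).
  case: eqP => [e _ | ne lti].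
    by constructor 2; lia.
  have [lt2|] := ltnP (i + t)%R.+1.*2 n.+1; first by constructor 1; lia.
  rewrite leq_eqVlt => /orP[/eqP e2|gt2]; last by constructor 2; lia.
  by constructor 4; split; lia.
- move=> c ltc; have ltcn : (c < n)%N by lia.
  have [i ic] := shift (eq (Ordinal ltcn)) (ex_intro _ _ erefl).
  exists i; rewrite /pi ordSD -ic val_ordS /=; case: eqP; lia.
- move=> on; have ltcn : (n./2 < n)%N by lia.
  have [i ic] := shift (eq (Ordinal ltcn)) (ex_intro _ _ erefl).
  exists i; rewrite /pi ordSD -ic val_ordS /=; case: eqP; lia.
Qed.

(** The axis crosses the edge between - t - 1 and - t and the opposite edge, so
the quotient path has a loop at both ends. *)
Lemma stable_clique_sum_reflection_edge t : ~~ odd n ->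
  stable_clique_sum (reflection (- (1 + t + t))) = transfer negb n./2 true.
Proof.
move=> en; pose pi i : nat := minn (i + t)%R (n - (i + t)%R.+1).
have shift (P : 'I_n -> Prop) : (exists j, P j) -> exists i, P (i + t).
  by move=> [j Pj]; exists (j - t); rewrite subrK.
have ordSD i : ordS i + t = ordS (i + t) by rewrite !ordS_add1 addrAC.
have n2 : n./2 = n./2.-1.+1 by lia.
rewrite n2; apply: (@stable_clique_sum_path n n./2.-1 _ pi true true) => //.
- by move=> i; rewrite /pi; have := ltn_ord (i + t); lia.
- move=> c le_c; apply: (shift (fun j => minn j (n - j.+1) = c)).
  have ltc : (c < n)%N by lia.
  by exists (Ordinal ltc) => /=; lia.
- move=> i j; rewrite mem_porbit_reflection.
  have -> : (j == - (1 + t + t) - i) = (j + t == rev_ord (i + t)).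
    rewrite rev_ordE -(inj_eq (@addIr _ t)); congr (_ == _); ring.
  rewrite -(inj_eq (@addIr _ t)) /pi; move: (i + t) (j + t) => u v.
  by rewrite -!val_eqE /=; have := ltn_ord u; have := ltn_ord v; lia.
- move=> i; rewrite /pi ordSD val_ordS; have := ltn_ord (i + t).
  case: eqP => [e _ | ne lti]; first by constructor 3; split; lia.
  have [lt2|] := ltnP (i + t)%R.+1.*2 n; first by constructor 1; lia.
  rewrite leq_eqVlt => /orP[/eqP e2|gt2]; last by constructor 2; lia.
  by constructor 4; split; lia.
- move=> c ltc; have ltcn : (c < n)%N by lia.
  have [i ic] := shift (eq (Ordinal ltcn)) (ex_intro _ _ erefl).
  exists i; rewrite /pi ordSD -ic val_ordS /=; case: eqP; lia.
- move=> _; have ltcn : (n.-1 < n)%N by lia.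
  have [i ic] := shift (eq (Ordinal ltcn)) (ex_intro _ _ erefl).
  exists i; rewrite /pi ordSD -ic val_ordS /=; case: eqP; lia.
- move=> _; have ltcn : (n./2.-1 < n)%N by lia.
  have [i ic] := shift (eq (Ordinal ltcn)) (ex_intro _ _ erefl).
  exists i; rewrite /pi ordSD -ic val_ordS /=; case: eqP; lia.
Qed.
End Dihedral.

(** * The automorphism group *)

Section DihedralAut.
Variable p : nat.
Local Notation n := p.+3.
Local Notation C := (compl (cycle_graph n)).
Implicit Types a i j t : 'I_n.

Lemma two_neq0 : (1 + 1 : 'I_n) != 0.
Proof. by []. Qed.

Lemma aut_compl_cycleP (T : {perm C}) :
  reflect (forall i j : 'I_n, i != j ->
      ((T j == T i + 1 :> 'I_n) || (T i == T j + 1 :> 'I_n)) =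
      ((j == i + 1) || (i == j + 1)))
    (T \in Aut_graph C).
Proof.
have adjE (x y : 'I_n) : @adj C x y = (x != y) && ~~ ((y == x + 1) || (x == y + 1)).
  rewrite /= /compl_adj /= /cycle_adj /= !ordS_add1.
  by case: (x =P y) => //= _.
rewrite inE; apply: (iffP idP) => [/forallP h i j ij | h].
  have /forallP/(_ j)/eqP := h i; rewrite !adjE.
  by rewrite (inj_eq (@perm_inj _ T)) ij /= => /negb_inj.
apply/forallP => i; apply/forallP => j; apply/eqP; rewrite !adjE.
rewrite (inj_eq (@perm_inj _ T)); case: eqP => //= /eqP ij.
by rewrite h.
Qed.

Lemma rotation_aut a : rotation a \in Aut_graph C.
Proof.
apply/aut_compl_cycleP => i j _; rewrite !permE.
by rewrite -!addrA !(inj_eq (addrI a)).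
Qed.

Lemma reflection_aut a : reflection a \in Aut_graph C.
Proof.
apply/aut_compl_cycleP => i j _; rewrite !permE orbC.
have E (x y : 'I_n) : (a - x == a - y + 1) = (y == x + 1).
  rewrite -(inj_eq (@addIr _ (x + y))) -[RHS](inj_eq (@addrI _ a)).
  by congr (_ == _); ring.
by rewrite !E.
Qed.

(** Along the cycle T moves by steps of 1 or - 1, and the step cannot change sign
because T is injective. *)
Lemma dihedral_aut (T : {perm C}) : T \in Aut_graph C ->
  exists a, T = rotation a \/ T = reflection a.
Proof.
move=> /aut_compl_cycleP aut.
pose f : 'I_n -> 'I_n := T.
have f_inj : injective f by exact: perm_inj.
have step i : f (i + 1) = f i + 1 \/ f (i + 1) = f i - 1.
  have ne : i != i + 1 by rewrite eq_sym -subr_eq0 addrAC subrr add0r.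
  have := aut i (i + 1) ne; rewrite eqxx /= => /orP[/eqP|/eqP] E; first by left.
  by right; rewrite /f E addrK.
have [e e1 fe] : exists2 e : 'I_n, e = 1 \/ e = -1 & f 1 = f 0 + e.
  by have := step 0; rewrite add0r => -[->|->]; [exists 1; first left|exists (-1); first right].
have step_e i : f (i + 1) = f i + e \/ f (i + 1) = f i - e.
  by case: e1 => ->; rewrite ?opprK //; case: (step i) => ->; [right|left].
(* A change of direction would identify the images of k and k + 2. *)
have f_nat k : f k%:R = f 0 + e *+ k /\ f k.+1%:R = f 0 + e *+ k.+1.
  elim: k => [|k [IH0 IH1]]; first by rewrite addr0.
  split=> //; have := step_e k.+1%:R; rewrite -mulrSr IH1 => -[->|].
    by rewrite -addrA -mulrSr.
  rewrite (mulrSr e) addrA addrK -IH0 => /f_inj; rewrite !mulrSr -addrA -[RHS]addr0.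
  by move/addrI/eqP; rewrite (negPf two_neq0).
exists (f 0); case: e1 => E; [left | right]; apply/permP => x; rewrite permE.
  have [+ _] := f_nat x; by rewrite E natr_Zp.
have [+ _] := f_nat x; by rewrite E mulNrn natr_Zp.
Qed.

Lemma rotation_inj : injective (@rotation p.+1).
Proof. by move=> a b /permP/(_ (0 : 'I_n)); rewrite !permE !addr0. Qed.

Lemma reflection_inj : injective (@reflection p.+1).
Proof. by move=> a b /permP/(_ (0 : 'I_n)); rewrite !permE !subr0. Qed.

Lemma rotation_neq_reflection a b : rotation a != reflection b.
Proof.
apply/eqP => /permP E; have := E (0 : 'I_n); have := E (1 : 'I_n).
rewrite !permE addr0 subr0 => + ab; rewrite ab => /addrI.
by move/eqP; rewrite -addr_eq0 (negPf two_neq0).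
Qed.

Lemma big_aut (V : Type) (idx : V) (op : Monoid.com_law idx) (F : {perm C} -> V) :
  \big[op/idx]_(T in Aut_graph C) F T =
  op (\big[op/idx]_(a < n) F (rotation a)) (\big[op/idx]_(a < n) F (reflection a)).
Proof.
pose rots := @rotation p.+1 @: setT; pose refls := @reflection p.+1 @: setT.
rewrite (eq_bigl [in [predU rots & refls]]) => [|T]; last first.
  apply/idP/orP => [/dihedral_aut[a [->|->]] | ].
  - by left; rewrite imset_f.
  - by right; rewrite imset_f.
  by case=> /imsetP[a _ ->]; rewrite ?rotation_aut ?reflection_aut.
rewrite bigU ?big_imset /=; first by congr (op _ _); apply: eq_bigl => a; rewrite inE.
- by move=> a b _ _ /reflection_inj.
- by move=> a b _ _ /rotation_inj.
rewrite disjoint_subset; apply/subsetP => _ /imsetP[a _ ->].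
by rewrite inE; apply/imsetP => -[b _ /eqP]; rewrite (negPf (rotation_neq_reflection a b)).
Qed.

Lemma card_aut : #|Aut_graph C| = (n + n)%N.
Proof. by rewrite -sum1_card big_aut /= !sum1_card card_ord. Qed.

End DihedralAut.

(** * Summation over the dihedral group *)

(** The signed sum of the independent sets of a cycle of length d > 0, with value
2 cos (pi d / 3). *)
Definition cycle_sum (d : nat) : int :=
  transfer predT d.-1 false - transfer negb d.-1 true.

Definition vertex_reflection_sum (n : nat) : int :=
  transfer (fun x => ~~ (odd n && x)) n./2.+1 false.

Definition edge_reflection_sum (n : nat) : int := transfer negb n./2 true.

Definition reflection_sum (n a : nat) : int :=
  if odd n || ~~ odd a then vertex_reflection_sum n else edge_reflection_sum n.

Lemma transfer_add6 t k q b : transfer t (q + 6 * k) b = transfer t q b.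
Proof.
elim: k => [|k IH]; first by rewrite muln0 addn0.
rewrite (_ : (q + 6 * k.+1 = q + 6 * k + 3 + 3)%N); last lia.
by rewrite !transfer_add3 opprK IH.
Qed.

(** The sum has period 6, and 2 cos (pi d / 3) is even in d, so it depends only on
the ideal generated by d modulo 6. *)
Lemma cycle_sum_gcd6 d : (0 < d)%N -> cycle_sum d = cycle_sum (gcdn d 6).
Proof.
case: d => // d _; rewrite (divn_eq d 6); move: (d %/ 6)%N (ltn_pmod d (isT : 0 < 6)%N).
move: (d %% 6)%N => r k ltr; rewrite -addnS gcdnC gcdnMDl.
rewrite {1}/cycle_sum addnS /= addnC mulnC !transfer_add6 gcdnC.
by do 6! case: r ltr => [//|r] ltr.
Qed.

Lemma vertex_reflection_sum_mod n k :
  vertex_reflection_sum (n + 12 * k) = vertex_reflection_sum n.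
Proof.
rewrite /vertex_reflection_sum (_ : odd (n + 12 * k) = odd n); last lia.
rewrite (_ : (n + 12 * k)./2.+1 = n./2.+1 + 6 * k)%N; last lia.
by rewrite transfer_add6.
Qed.

Lemma edge_reflection_sum_mod n k :
  edge_reflection_sum (n + 12 * k) = edge_reflection_sum n.
Proof.
rewrite /edge_reflection_sum (_ : (n + 12 * k)./2 = n./2 + 6 * k)%N; last lia.
by rewrite transfer_add6.
Qed.

Lemma sum_periodic (g n : nat) (h : nat -> int) : (g %| n)%N ->
  (forall a, h (a + g)%N = h a) ->
  \sum_(a < n) h a = (\sum_(a < g) h a) *+ (n %/ g).
Proof.
case: g => [|g]; first by rewrite dvd0n => /eqP ->; rewrite !big_ord0 mul0rn.
move=> /dvdnP[k ->] hg; rewrite mulnK // mulnC.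
elim: k => [|k IH]; first by rewrite muln0 big_ord0 mulr0n.
rewrite mulnS addnC big_split_ord /= IH mulrSr; congr (_ + _).
apply: eq_bigr => a _; elim: k {IH} => [|k IH]; first by rewrite muln0.
by rewrite -IH -[RHS]hg; congr h; rewrite mulnS; lia.
Qed.

(** Only g = gcd(n, 6) matters: the summand has period g in a, and its sum over a
period is 1 for g = 1 and vanishes for g = 2, 3 and 6. *)
Lemma sum_cycle_sum n : (0 < n)%N ->
  \sum_(a < n) cycle_sum (gcdn n a) = if coprime n 6 then n%:R else 0.
Proof.
move=> n_gt0; have := dvdn_gcdl n 6; have := dvdn_gcdr n 6.
rewrite /coprime; under eq_bigr => a _.
  rewrite cycle_sum_gcd6 ?gcdn_gt0 ?n_gt0 // -gcdnA [gcdn a 6]gcdnC gcdnA.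
  over.
move: (gcdn n 6) => g g6 gn.
rewrite (sum_periodic (h := fun a => cycle_sum (gcdn g a)) gn); last first.
  by move=> a; rewrite gcdnDr.
have : g \in divisors 6 by rewrite -dvdn_divisors.
rewrite [divisors 6](_ : _ = [:: 1; 2; 3; 6]%N) // !inE.
case/or4P => /eqP ->; rewrite !big_ord_recr big_ord0 /=.
- by rewrite divn1; congr (_ *+ _).
- by rewrite [X in X *+ _](_ : _ = 0) ?mul0rn.
- by rewrite [X in X *+ _](_ : _ = 0) ?mul0rn.
- by rewrite [X in X *+ _](_ : _ = 0) ?mul0rn.
Qed.

(** For n = 2 m the reflections through vertices give a path on m + 1 free
vertices, and those through edges a path on m - 2 free vertices: the lengths
differ by 3, so the values cancel. *)
Lemma sum_reflection_sum n :
  \sum_(a < n) reflection_sum n a =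
  if odd n then vertex_reflection_sum n *+ n else 0.
Proof.
rewrite /reflection_sum; case: (boolP (odd n)) => [|en] /=.
  by rewrite sumr_const card_ord.
rewrite (sum_periodic (g := 2) (h := fun a => if ~~ odd a
  then vertex_reflection_sum n else edge_reflection_sum n)) ?dvdn2 //; last first.
  by move=> a; rewrite oddD addbF.
rewrite !big_ord_recr big_ord0 /= add0r (_ : _ + _ = 0) ?mul0rn //.
rewrite /vertex_reflection_sum (negPf en) /edge_reflection_sum.
move: n./2 => m; elim/ltn_ind: m => m IH.
case: m IH => [//|[//|[//|m]]] IH.
by rewrite -[m.+4]addn3 -[m.+3]addn3 !transfer_add3 -opprD IH ?oppr0 //; lia.
Qed.

Lemma total_sum n : (0 < n)%N ->
  \sum_(a < n) cycle_sum (gcdn n a) + \sum_(a < n) reflection_sum n a =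
  if (n %% 12 == 1)%N || (n %% 12 == 11)%N then (n + n)%:R else 0.
Proof.
move=> n_gt0; rewrite sum_cycle_sum // sum_reflection_sum.
have -> : coprime n 6 = coprime (n %% 12) 6.
  rewrite {1}(divn_eq n 12) /coprime ![gcdn _ 6]gcdnC.
  by rewrite (_ : n %/ 12 * 12 = n %/ 12 * 2 * 6)%N ?gcdnMDl //; lia.
have -> : odd n = odd (n %% 12) by lia.
have -> : vertex_reflection_sum n = vertex_reflection_sum (n %% 12).
  by rewrite {1}(divn_eq n 12) addnC mulnC vertex_reflection_sum_mod.
move: (n %% 12)%N (ltn_pmod n (isT : 0 < 12)%N) => r.
move=> ltr; have table : (if coprime r 6 then 1 else 0) +
    (if odd r then vertex_reflection_sum r else 0) =
    if (r == 1)%N || (r == 11)%N then 1 + 1 else 0 :> int.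
  by do 12! case: r ltr => [//|r] ltr.
transitivity (((if coprime r 6 then 1 else 0) +
    (if odd r then vertex_reflection_sum r else 0)) *+ n).
  by rewrite [RHS]mulrnDl; congr (_ + _); case: ifP; rewrite ?mul0rn.
by rewrite table; case: ifP; rewrite ?mul0rn // natrD [LHS]mulrnDl.
Qed.

(** The values of 1 - chi(T) over the dihedral group, as a condition on n alone:
this is the form in which two different n can be compared. *)
Definition lefschetz_sum (n : nat) (v : int) : Prop :=
  [\/ exists a, (a < n)%N /\ v = cycle_sum (gcdn n a), v = vertex_reflection_sum n
    | ~~ odd n /\ v = edge_reflection_sum n].

Lemma lefschetz_sum_add12 n v : (0 < n)%N ->
  lefschetz_sum (n + 12) v <-> lefschetz_sum n v.
Proof.
move=> n_gt0.
have rot m m' : (0 < m)%N -> (0 < m')%N -> gcdn m 6 = gcdn m' 6 ->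
    forall a, exists2 b, (b < m')%N & cycle_sum (gcdn m a) = cycle_sum (gcdn m' b).
  move=> m0 m'0 e a; exists (a %% gcdn m' 6)%N.
    have g_gt0 : (0 < gcdn m' 6)%N by rewrite gcdn_gt0 m'0.
    exact: leq_trans (ltn_pmod a g_gt0) (dvdn_leq m'0 (dvdn_gcdl _ _)).
  (* cycle_sum only sees gcd(m, 6), of which both m and m' are multiples. *)
  have gE k c : (0 < k)%N -> cycle_sum (gcdn k c) = cycle_sum (gcdn (gcdn k 6) c).
    by move=> k0; rewrite cycle_sum_gcd6 ?gcdn_gt0 ?k0 // -!gcdnA [gcdn c 6]gcdnC.
  by rewrite gE // [RHS]gE // e gcdn_modr.
have e : gcdn (n + 12) 6 = gcdn n 6.
  by rewrite -[12%N]/(2 * 6)%N addnC gcdnC gcdnMDl gcdnC.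
have V := vertex_reflection_sum_mod n 1; have E := edge_reflection_sum_mod n 1.
rewrite muln1 in V E.
have on : odd (n + 12) = odd n by lia.
split=> -[[a [_ ->]] | -> | [o ->]]; rewrite ?V ?E.
- by have [b lb ->] := rot _ _ (ltn_addr 12 n_gt0) n_gt0 e a; constructor 1; exists b.
- by constructor 2.
- by constructor 3; rewrite -on.
- by have [b lb ->] := rot _ _ n_gt0 (ltn_addr 12 n_gt0) (esym e) a; constructor 1; exists b.
- by constructor 2; rewrite V.
- by constructor 3; rewrite on E.
Qed.

Section Lefschetz.
Variables (R : realType) (p : nat).
Local Notation n := p.+3.
Local Notation C := (compl (cycle_graph n)).

Lemma lefschetz_rotation (a : 'I_n) :
  lefschetz R (rotation a) = (1 - cycle_sum (gcdn n a))%:~R.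
Proof. by rewrite lefschetz_cliques ?rotation_aut // stable_clique_sum_rotation. Qed.

(** A reflection i |-> a - i passes through a vertex when a is twice something
modulo n, which always happens for odd n: then a or a + n is even. *)
Lemma lefschetz_reflection (a : 'I_n) :
  lefschetz R (reflection a) = (1 - reflection_sum n a)%:~R.
Proof.
rewrite lefschetz_cliques ?reflection_aut //; congr ((1 - _)%:~R).
have n0 : n%:R = 0 :> 'I_n by apply: (@pchar_Zp n).
have vtx (h : nat) : a = (h + h)%:R -> stable_clique_sum (reflection a) = vertex_reflection_sum n.
  move=> ->; rewrite (_ : (h + h)%:R = - (- h%:R + - h%:R)).
    exact: stable_clique_sum_reflection_vertex.
  by rewrite -opprD opprK natrD.
rewrite /reflection_sum; case: (boolP (odd a)) => [oa | ea].
  case: (boolP (odd n)) => on /=.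
    by apply: (vtx (a + n)./2); rewrite -[a in LHS]natr_Zp -[LHS]addr0 -n0 -natrD; congr _%:R; lia.
  rewrite (_ : a = - (1 + - a./2.+1%:R + - a./2.+1%:R)).
    exact: stable_clique_sum_reflection_edge.
  have half : a%:R + 1 = a./2.+1%:R + a./2.+1%:R :> 'I_n.
    by rewrite -mulrSr -natrD; congr _%:R; lia.
  by rewrite -[LHS]natr_Zp -[LHS](addrK 1) half; ring.
by rewrite orbT; apply: (vtx a./2); rewrite -[a in LHS]natr_Zp; congr _%:R; lia.
Qed.

Lemma mem_lefschetz_numbers r :
  lefschetz_numbers R C r <-> exists2 v, lefschetz_sum n v & r = (1 - v)%:~R.
Proof.
split=> [[T /dihedral_aut[a [->|->]] <-] | [v sv ->]].
- exists (cycle_sum (gcdn n a)); last by rewrite lefschetz_rotation.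
  by constructor 1; exists a.
- exists (reflection_sum n a); last by rewrite lefschetz_reflection.
  rewrite /reflection_sum; case: ifP => [_ | /norP[on _]]; first by constructor 2.
  by constructor 3.
case: sv => [[a [lta ->]] | -> | [en ->]].
- exists (rotation (Ordinal lta)); first exact: rotation_aut.
  by rewrite lefschetz_rotation.
(* Reflecting with a = 0 goes through a vertex, with a = 1 through an edge. *)
- exists (reflection 0); first exact: reflection_aut.
  by rewrite lefschetz_reflection /reflection_sum orbT.
- exists (reflection 1); first exact: reflection_aut.
  by rewrite lefschetz_reflection /reflection_sum (negPf en).
Qed.

Lemma average_lefschetzE :
  average_lefschetz R C =
  if (n %% 12 == 1)%N || (n %% 12 == 11)%N then 0 else 1.
Proof.
rewrite /average_lefschetz card_aut big_aut /=.
have -> : \sum_(a < n) lefschetz R (rotation a) + \sum_(a < n) lefschetz R (reflection a) =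
  ((n + n)%:R - (\sum_(a < n) cycle_sum (gcdn n a) + \sum_(a < n) reflection_sum n a))%:~R.
  rewrite (eq_bigr _ (fun a _ => lefschetz_rotation a)).
  rewrite (eq_bigr _ (fun a _ => lefschetz_reflection a)).
  rewrite -!rmorph_sum -rmorphD /= !sumrB !sumr_const card_ord.
  by congr _%:~R; rewrite natrD; ring.
rewrite total_sum //; case: ifP => _; first by rewrite subrr mul0r.
by rewrite subr0 rmorph_nat divff // pnatr_eq0.
Qed.

End Lefschetz.

Theorem theorem12 (R : realType) :
  (forall n : nat, (4 <= n)%N ->
     lefschetz_numbers R (compl (cycle_graph (n + 12)))
     = lefschetz_numbers R (compl (cycle_graph n))) /\
  (forall n : nat, (4 <= n)%N ->
     let exceptional :=
       exists2 k : nat, (1 <= k)%N & (n = 12 * k - 1 \/ n = 12 * k + 1)%N in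
     (~ exceptional ->
        average_lefschetz R (compl (cycle_graph n)) = 1) /\
     (exceptional ->
        average_lefschetz R (compl (cycle_graph n)) = 0)).
Proof.
have numbersE n r : (4 <= n)%N -> lefschetz_numbers R (compl (cycle_graph n)) r <->
    exists2 v, lefschetz_sum n v & r = (1 - v)%:~R.
  by case: n => [|[|[|p]]] // _; apply: mem_lefschetz_numbers.
split=> [n n4 | [|[|[|p]]] // n4 exceptional].
  have n12 : (4 <= n + 12)%N by rewrite ltn_addr.
  have n0 : (0 < n)%N by apply: leq_trans n4.
  apply/seteqP; split=> r /numbersE => [/(_ n12) | /(_ n4)] [v sv ->];
    by apply/numbersE => //; exists v => //; apply/(lefschetz_sum_add12 v n0).
have excP : exceptional <-> (p.+3 %% 12 == 1)%N || (p.+3 %% 12 == 11)%N.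
  split=> [[k k1 [->|->]] | h]; [lia|lia|].
  by exists ((p.+3 + 1) %/ 12)%N; lia.
rewrite average_lefschetzE; split=> [ne | /excP -> //].
by case: ifP => // /excP.
Qed.
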